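(* Let $n\geq k\geq l\geq 1$ be integers. Let $\Gamma_{k,l}$ be the set of families $\gamma=(\gamma_i)_{i\in[n]\setminus\{k\}}$ of pairwise disjoint lattice paths such that $\gamma_i$ goes from $A_i$ to $B_i$ for $1\leq i<l$ and for $k<i\leq n$, and $\gamma_i$ goes from $A_{i+1}$ to $B_i$ for $l\leq i<k$, where $A_i=(i-1,2i-1)$ and $B_i=(2i-1,2i-1)$. Then $$c_{k,l}(q)=\sum_{\gamma\in\Gamma_{k,l}}\psi(\gamma).$$
   Context: For $m\in\mathbb Z$ and $r\in\mathbb N$, $(x;q)_r=(1-x)(1-xq)\cdots(1-xq^{r-1})$ and ${m\brack r}_q=\frac{(q^{m-r+1};q)_r}{(q;q)_r}$; entries with negative lower index are $0$. Let $G_q$ be the (lower unitriangular) infinite matrix $G_q=\left({i\brack 2i-2j}_q\,q^{(i-j-1)(i-j)}\right)_{i,j\geq 1}$ and write its inverse as $G_q^{-1}=((-1)^{i-j}c_{i,j}(q))_{i,j\geq 1}$. A lattice path from $(a,b)$ to $(c,d)$ is a sequence of integer points starting at $(a,b)$ and ending at $(c,d)$ in which each step is either $(1,0)$ or $(0,-1)$. For such a path $w$, let $|\lambda_w|=\sum (x-a)$, the sum over all steps $(0,-1)$ of $w$, $x$ being the abscissa of that step. Two paths are disjoint if they have no common point. For a family $\gamma=(\gamma_i)$ of paths, $\psi(\gamma)=q^{\sum_i|\lambda_{\gamma_i}|}$. *)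

(* Defs.v *)
From HB Require Import structures.
From mathcomp Require Import all_boot all_order all_algebra.
From mathcomp Require Import classical_sets fsbigop.

Set Implicit Arguments.
Unset Strict Implicit.
Unset Printing Implicit Defensive.

Import GRing.Theory.
Local Open Scope ring_scope.

(* q is an indeterminate over the rationals. *)
Definition Kq : fieldType := {fraction {poly rat}}.
Definition q : Kq := tofrac 'X.

Definition qpoch (x : Kq) (r : nat) : Kq := \prod_(s < r) (1 - x * q ^+ s).

(* Here m - r + 1 may be negative, hence integer powers of q. *)
Definition qbinom (m r : int) : Kq :=
  match r with
  | Posz r' => qpoch (q ^ (m - r'%:Z + 1)) r' / qpoch q r'
  | Negz _ => 0
  end.

(* Infinite matrices with rows and columns indexed by 1, 2, 3, ...; the entries
   at index 0 are junk and are never used. *)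
Definition infmx := nat -> nat -> Kq.

Definition lower_triangular (M : infmx) : Prop :=
  forall i j, (0 < i)%N -> (i < j)%N -> M i j = 0.

(* Meaningful when M is lower triangular: the omitted terms, r > i, vanish. *)
Definition mul_lower (M N : infmx) : infmx :=
  fun i j => \sum_(1 <= r < i.+1) M i r * N r j.

Definition is_identity (M : infmx) : Prop :=
  forall i j, (0 < i)%N -> (0 < j)%N -> M i j = (i == j)%:R.

Definition is_inverse (M N : infmx) : Prop :=
  [/\ lower_triangular N,
      is_identity (mul_lower M N) & is_identity (mul_lower N M)].

(* The last exponent is nonnegative for i >= j, and qbinom is 0 for i < j. *)
Definition Gq : infmx := fun i j =>
  let d : int := i%:Z - j%:Z in
  qbinom i%:Z (2 * i%:Z - 2 * j%:Z) * q ^ ((d - 1) * d).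

Definition signed (c : infmx) : infmx :=
  fun i j => (-1) ^ (i%:Z - j%:Z) * c i j.

Definition lpoint : Type := (int * int)%type.

Definition lattice_step : rel lpoint :=
  fun P Q => (Q == P + (1, 0)) || (Q == P + (0, -1)).

Definition is_lattice_path (P Q : lpoint) (w : seq lpoint) : bool :=
  if w is x :: p then [&& x == P, path lattice_step x p & last x p == Q]
  else false.

Definition steps (w : seq lpoint) : seq (lpoint * lpoint) := zip w (behead w).

Definition is_down (s : lpoint * lpoint) : bool := s.2 == s.1 + (0, -1).

Definition lambda_size (w : seq lpoint) : int :=
  \sum_(s <- steps w | is_down s) (s.1.1 - (head 0 w).1).

Definition disjoint_paths (w w' : seq lpoint) : Prop :=
  forall P, ~ (P \in w /\ P \in w').

(* The set {1, ..., n} minus k, as a finite type. *)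
Definition idxset (n k : nat) : Type :=
  {i : 'I_n.+1 | (0 < i)%N && (i != k :> nat)}.
Definition idx (n k : nat) (i : idxset n k) : nat := \val (\val i).

Definition path_family (n k : nat) : Type := {ffun idxset n k -> seq lpoint}.

Definition ptA (i : nat) : lpoint := (i%:Z - 1, 2 * i%:Z - 1).
Definition ptB (i : nat) : lpoint := (2 * i%:Z - 1, 2 * i%:Z - 1).

Definition start (k l i : nat) : lpoint :=
  if (l <= i < k)%N then ptA i.+1 else ptA i.

(* This set is finite, so summing over it with [\sum_(g \in _)], which is 0 by
   convention when infinitely many terms are nonzero, is the usual finite sum. *)
Definition Gamma (n k l : nat) : set (path_family n k) :=
  fun g => (forall i, is_lattice_path (start k l (idx i)) (ptB (idx i)) (g i)) /\
           (forall i j, i != j -> disjoint_paths (g i) (g j)).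

Arguments Gamma n k l : clear implicits.

Definition psi (n k : nat) (g : path_family n k) : Kq :=
  q ^ (\sum_i lambda_size (g i)).

(* Main.v *)
Require Import Defs.
From mathcomp Require Import all_boot all_order all_algebra.
From mathcomp Require Import classical_sets functions fsbigop.
From mathcomp Require Import zify ring.
Set Implicit Arguments.
Unset Strict Implicit.
Unset Printing Implicit Defensive.
Import Order.TTheory GRing.Theory Num.Theory.
Local Open Scope ring_scope.

(** In a family of Gamma the paths gamma_i with i < l or i > k are horizontal, and
    gamma_i with l <= i < k is determined by the abscissae i <= s_i <= t_i < 2i of
    its two down steps.  Two paths can only meet when their indices are
    consecutive, and gamma_i, gamma_(i+1) are disjoint iff s_i < t_(i+1).  The
    entry of Gq at (k, l) is the same weighted sum over chains satisfying the
    opposite conditions t_(i+1) <= s_i, because the concatenation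
    s_(k-1) <= t_(k-1) <= s_(k-2) <= ... <= t_l is a path from A_k to B_l.
    Splitting a chain at the point where strict conditions give way to weak ones
    yields a telescoping alternating sum, which says that the two families of sums
    form inverse matrices up to signs. *)

(** * Chains of down-step abscissae and their alternating sums *)

Definition pair_weight (i : nat) (p : nat * nat) : Kq :=
  q ^+ (p.1 - i + (p.2 - i)).

(* A chain lists, for i = l + d - 1 down to l, the abscissae s_i <= t_i of the
   two down steps of the path from A_(i+1) to B_i.  Paths i + 1 and i are disjoint
   iff s_i < t_(i+1); b stands for the bound t_(l+d) on the first s. *)
Fixpoint chains (l d b : nat) : seq (seq (nat * nat)) :=
  if d is d'.+1 then
    let i := (l + d')%N in
    [seq p :: ch | p <- [seq (s, t) | s <- [seq s <- index_iota i i.*2 | (s < b)%N],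
                                      t <- index_iota s i.*2],
                   ch <- chains l d' p.2]
  else [:: [::]].

Fixpoint chain_weight (l : nat) (ch : seq (nat * nat)) : Kq :=
  if ch is p :: ch' then pair_weight (l + size ch') p * chain_weight l ch'
  else 1.

Definition chain_sum (l d b : nat) : Kq :=
  \sum_(ch <- chains l d b) chain_weight l ch.

(* The same sum with every strict inequality s_i < t_(i+1) negated: the 2d
   abscissae, read along one path from A_(l+d) to B_l, are weakly increasing. *)
Fixpoint weak_chain_sum (l d b : nat) : Kq :=
  if d is d'.+1 then
    let i := (l + d')%N in
    \sum_(i <= s < i.*2 | (b <= s)%N) \sum_(s <= t < i.*2)
      pair_weight i (s, t) * weak_chain_sum l d' t
  else 1.

Lemma size_chains l d b ch : ch \in chains l d b -> size ch = d.
Proof.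
elim: d b ch => [|d IHd] b ch /=; first by rewrite inE => /eqP ->.
by case/allpairsPdep=> p [ch' [_ /IHd <- ->]].
Qed.

Lemma chain_sumS l d b : chain_sum l d.+1 b =
  \sum_(l + d <= s < (l + d).*2 | (s < b)%N) \sum_(s <= t < (l + d).*2)
    pair_weight (l + d) (s, t) * chain_sum l d t.
Proof.
rewrite /chain_sum /= big_allpairs_dep big_allpairs_dep big_filter.
apply: eq_bigr => s _; apply: eq_bigr => t _.
rewrite big_distrr /=; apply: eq_big_seq => ch /size_chains sz_ch /=.
by rewrite sz_ch.
Qed.

Lemma chain_sum0 l b : chain_sum l 0 b = 1.
Proof. by rewrite /chain_sum big_seq1. Qed.

(* Inclusion-exclusion at the junction of the strict and the weak part: the
   terms j = d + 1 and j <= d of the sum for d + 1 combine into those with b <= s. *)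
Lemma chain_weak_chain_sum l d b :
  \sum_(0 <= j < d.+1)
    (-1) ^+ (d - j) * chain_sum (l + j) (d - j) b * weak_chain_sum l j 0 =
  weak_chain_sum l d b.
Proof.
elim: d b => [|d IHd] b; first by rewrite big_nat1 chain_sum0 !mulr1.
rewrite big_nat_recr //= subnn chain_sum0 !mul1r.
rewrite [X in _ + X](bigID (fun s => (s < b)%N)) /=.
under [X in _ + (_ + X)]eq_bigl => s do rewrite -leqNgt.
(* The part with [b <= s] is the right-hand side, so the part with [s < b] must cancel the terms
   [j <= d]. *)
rewrite addrA -[RHS]add0r; congr (_ + _).
(* [IHd] at the bound [t] re-expands the inner weak sum; the two sums then cancel for each [j],
   their signs being opposite. *)
under [X in _ + X]eq_bigr => s _ do under eq_bigr => t _ do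
  rewrite -IHd mulr_sumr.
under [X in _ + X]eq_bigr => s _ do rewrite exchange_big_nat //=.
rewrite [X in _ + X]exchange_big_nat //= -big_split /= big_nat big1 // => j.
case/andP=> _ ltjd; rewrite subSn // chain_sumS exprS mulN1r.
rewrite -addnA subnKC // !mulNr addrC; apply/eqP; rewrite subr_eq0; apply/eqP.
rewrite -mulrA mulr_suml mulr_sumr; apply: eq_bigr => s _.
rewrite mulr_suml mulr_sumr; apply: eq_bigr => t _; ring.
Qed.

Lemma weak_chain_sum_eq0 l d b : ((l + d).*2 <= b)%N -> weak_chain_sum l d.+1 b = 0.
Proof.
move=> le_b /=; rewrite big_nat_cond big1 // => s; lia.
Qed.

(** * Entries of [Gq] as complete homogeneous polynomials *)

(* The complete homogeneous symmetric polynomial h_m(q^a, ..., q^(b-1)). *)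
Fixpoint qhom (m a b : nat) : Kq :=
  if m is m'.+1 then \sum_(a <= x < b) q ^+ x * qhom m' x b else 1.

(** Monomials are split by whether they contain the first variable [q ^+ a]; this q-Pascal
    recurrence drives a double induction on [m] and [e]. *)
Lemma qhomE m a e :
  qhom m a (a + e) * qpoch q m = q ^+ (a * m) * qpoch (q ^+ e) m.
Proof.
elim: m a e => [|m IHm] a e.
  by rewrite /qpoch !big_ord0 muln0 mulr1.
elim: e a => [|e IHe] a.
  rewrite addn0 /= big_geq // mul0r /qpoch big_ord_recl /= mulr1 subrr.
  by rewrite mul0r mulr0.
have IHe' := IHe a.+1; have IHm' := IHm a e.+1.
rewrite addSnnS in IHe'.
have -> : qhom m.+1 a (a + e.+1) =
    q ^+ a * qhom m a (a + e.+1) + qhom m.+1 a.+1 (a + e.+1).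
  by rewrite /= big_ltn // addnS ltnS leq_addr.
rewrite mulrDl IHe'.
have -> : qpoch q m.+1 = qpoch q m * (1 - q ^+ m.+1).
  by rewrite /qpoch big_ord_recr /= -exprS.
rewrite -mulrA (mulrA _ (qpoch q m)) IHm'.
have -> : qpoch (q ^+ e.+1) m.+1 = qpoch (q ^+ e.+1) m * (1 - q ^+ (e + m.+1)).
  by rewrite /qpoch big_ord_recr /= -exprD addSnnS.
have -> : qpoch (q ^+ e) m.+1 = (1 - q ^+ e) * qpoch (q ^+ e.+1) m.
  rewrite /qpoch big_ord_recl mulr1; congr (_ * _).
  by apply: eq_bigr => s _; rewrite -!exprD /bump /= addSnnS.
rewrite mulSn mulnS !exprD; ring.
Qed.

Lemma qpoch_neq0 m : qpoch q m != 0.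
Proof.
rewrite /qpoch prodf_seq_neq0; apply/allP => s _ /=.
rewrite -exprS subr_eq0 /q -rmorphXn /= -tofrac1 tofrac_eq.
apply/eqP => /(congr1 (fun p : {poly rat} => p`_s.+1)).
by rewrite coefXn coef1 eqxx.
Qed.

Lemma q_neq0 : q != 0.
Proof. by rewrite tofrac_eq0 polyX_eq0. Qed.

Lemma qhom_geq m a b : (b <= a)%N -> qhom m.+1 a b = 0.
Proof. by move=> leba /=; rewrite big_geq. Qed.

(** A weak chain is one weakly increasing sequence of [d.*2] abscissae from [a] on. As its last term
    is below [l.*2], the larger upper bounds are automatic; the hypothesis on [a] makes the lower
    bounds automatic too. The power of q undoes the shifts by [i] in [pair_weight]. *)
Lemma weak_chain_sum_qhom l d a : (l + d <= a.+1)%N ->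
  weak_chain_sum l d a * q ^+ (\sum_(0 <= i < d) (l + i).*2) = qhom d.*2 a l.*2.
Proof.
elim: d a => [|d IHd] a le_a; first by rewrite big_geq // mulr1.
have cut s (F : nat -> Kq) :
    (forall t, (l.*2 <= t < (l + d).*2)%N -> F t = 0) ->
    \sum_(s <= t < (l + d).*2) F t = \sum_(s <= t < l.*2) F t.
  move=> F0; have [le_s|lt_s] := leqP s l.*2.
    rewrite (@big_cat_nat _ _ _ l.*2) //=; last by lia.
    rewrite [X in _ + X]big_nat [X in _ + X]big1 ?addr0 // => t; exact: F0.
  rewrite [RHS]big_geq; last by lia.
  rewrite big_nat big1 // => t lt_t; apply: F0; lia.
rewrite big_nat_recr //= exprD mulrA.
have widen (F : nat -> Kq) : \sum_(l + d <= s < (l + d).*2 | (a <= s)%N) F s =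
    \sum_(a <= s < (l + d).*2) F s.
  by rewrite [RHS](big_nat_widenl a (l + d)) //; lia.
rewrite widen; set e := (\sum_(0 <= i < d) (l + i).*2)%N in IHd *; clearbody e.
rewrite !mulr_suml.
under [LHS]eq_big_nat => s /andP[le_s lt_s].
  rewrite !mulr_suml.
  under eq_big_nat => t /andP[le_t lt_t].
    have -> : pair_weight (l + d) (s, t) * weak_chain_sum l d t *
       q ^+ e * q ^+ (l + d).*2 =
       q ^+ s * (q ^+ t * qhom d.*2 t l.*2).
      rewrite -IHd; last by lia.
      have -> : q ^+ s = q ^+ (s - (l + d)) * q ^+ (l + d).
        by rewrite -exprD subnK //; lia.
      have -> : q ^+ t = q ^+ (t - (l + d)) * q ^+ (l + d).
        by rewrite -exprD subnK //; lia.
      by rewrite /pair_weight /= -addnn !exprD; ring.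
    over.
  rewrite -mulr_sumr cut; last first.
    move=> t; case: (d) => [|d']; first by rewrite addn0; lia.
    by case/andP=> le_t' _; rewrite doubleS qhom_geq ?mulr0.
  over.
rewrite cut // => s /andP[le_s _].
by rewrite [X in _ * X]big_geq ?mulr0.
Qed.

Lemma qbinom_natE (a m : nat) (x : int) : x + 1 = m%:Z + a%:Z ->
  qbinom x m = qpoch (q ^+ a) m / qpoch q m.
Proof. by move=> xE; rewrite /qbinom addrAC xE addrC addKr. Qed.

Lemma sum_double_shift l d :
  (\sum_(0 <= i < d) (l + i).*2 + d = (l + l + d) * d)%N.
Proof.
elim: d => [|d IHd]; first by rewrite big_geq // muln0.
rewrite big_nat_recr //=; nia.
Qed.

(** For [0 < d <= l] the weak sum is, up to a power of q, h_(2d) in the l-d+1 variables q^(l+d-1),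
    ..., q^(2l-1). This gives the q-binomial, and the remaining power is q^(d(d-1)). *)
Lemma Gq_weak_chain_sum l d : (0 < l)%N ->
  Gq (l + d) l = weak_chain_sum l d 0.
Proof.
move=> l_gt0; rewrite /Gq.
have -> : (l + d)%:Z - l%:Z = d%:Z by lia.
have -> : 2 * (l + d)%:Z - 2 * l%:Z = d.*2%:Z by lia.
case: d => [|d].
  rewrite (@qbinom_natE (l + 1)); last by lia.
  by rewrite /qpoch !big_ord0 divr1 mulr0 expr0z mulr1.
(* Every [s] in the outer sum is at least [l + d], so the bound 0 may be raised to meet the
   hypothesis of [weak_chain_sum_qhom]. *)
have -> : weak_chain_sum l d.+1 0 = weak_chain_sum l d.+1 (l + d).
  rewrite /= big_nat_cond [RHS]big_nat_cond; apply: eq_bigl => s /=.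
  by rewrite andbT; case: (l + d <= s)%N; rewrite ?andbT.
have := @weak_chain_sum_qhom l d.+1 (l + d); rewrite addnS => /(_ (leqnn _)).
have [le_ld|lt_ld] := leqP l d.
  rewrite doubleS qhom_geq; last by lia.
  move/eqP; rewrite mulf_eq0 (negPf (expf_neq0 _ q_neq0)) orbF => /eqP ->.
  (* No variable is left here, and the numerator of the q-binomial vanishes through its factor of
     index [d - l], which is 1 - q^0. *)
  have lt_o : (d - l < d.*2.+2)%N by lia.
  rewrite /qbinom /qpoch (bigD1 (Ordinal lt_o)) //= [q ^+ (d - l)]exprnP.
  rewrite -expfzDr ?q_neq0 //.
  have -> : (l + d.+1)%:Z - d.*2.+2%:Z + 1 + (d - l)%N%:Z = 0 by lia.
  by rewrite expr0z subrr !mul0r.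
have := @qhomE d.*2.+2 (l + d) (l - d).
have -> : (l + d + (l - d) = l.*2)%N by lia.
move=> qE AE; rewrite (qbinom_natE (a := l - d)); last by lia.
apply: (mulIf (expf_neq0 (\sum_(0 <= i < d.+1) (l + i).*2) q_neq0)).
apply: (mulIf (qpoch_neq0 d.+1.*2)); rewrite AE doubleS qE.
have -> : (d.+1%:Z - 1) * d.+1%:Z = (d * d.+1)%N by lia.
have -> : ((l + d) * d.*2.+2 = d * d.+1 + \sum_(0 <= i < d.+1) (l + i).*2)%N.
  have := sum_double_shift l d.+1; nia.
rewrite -exprnP exprD.
move: (qpoch (q ^+ (l - d)) _) (qpoch q _) (qpoch_neq0 d.*2.+2) => x y y_neq0.
by rewrite mulrAC (mulrAC _ _ y) divfK // -[LHS]mulrA [LHS]mulrC.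
Qed.

(** * Inversion of [Gq] *)

Lemma Gq_upper i j : (i < j)%N -> Gq i j = 0.
Proof.
move=> lt_ij; rewrite /Gq /qbinom.
have -> : 2 * i%:Z - 2 * j%:Z = Negz (j - i).*2.-1 by rewrite NegzE; lia.
by rewrite mul0r.
Qed.

(** This is [chain_weak_chain_sum] at the bound [k.*2], which exceeds all abscissae: for [l < k] no
    weak chain meets it, so the sum is 0. *)
Lemma chain_sum_inverse k l : (0 < l <= k)%N ->
  \sum_(l <= r < k.+1) (-1) ^+ (k - r) * chain_sum r (k - r) k.*2 * Gq r l =
  (k == l)%:R.
Proof.
case/andP=> l_gt0 le_lk; have [d ->] : exists d, k = (l + d)%N.
  by exists (k - l)%N; rewrite subnKC.
have -> : ((l + d == l) = (d == 0))%N by lia.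
rewrite -[X in \sum_(X <= _ < _) _]add0n big_addn subSn ?leq_addr // addKn.
under eq_big_nat => j _ do rewrite (addnC j) Gq_weak_chain_sum // subnDl.
rewrite chain_weak_chain_sum; case: d => [|d]; first by rewrite eqxx.
by rewrite weak_chain_sum_eq0; last by lia.
Qed.

(** Back substitution from [r = k] downwards: [u l] has coefficient 1 and the later unknowns already
    agree. *)
Lemma unitriangular_row_unique (M : infmx) (u v : nat -> Kq) (k l0 : nat) :
    (forall l, M l l = 1) ->
    (forall l, (l0 <= l <= k)%N ->
      \sum_(l <= r < k.+1) u r * M r l = \sum_(l <= r < k.+1) v r * M r l) ->
  forall l, (l0 <= l <= k)%N -> u l = v l.
Proof.
move=> M1 uvE l /andP[le_l0l le_lk].
have [n] := ubnP (k - l); elim: n l le_l0l le_lk => // n IHn l le_l0l le_lk ltn.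
have := uvE l; rewrite le_l0l le_lk => /(_ isT).
rewrite [LHS]big_ltn // [RHS]big_ltn // M1 !mulr1.
suff -> : \sum_(l.+1 <= r < k.+1) u r * M r l =
          \sum_(l.+1 <= r < k.+1) v r * M r l by move/addIr.
by apply: eq_big_nat => r lt_r; rewrite IHn //; lia.
Qed.

Lemma inverse_chain_sum (c : infmx) k l : is_inverse Gq (signed c) ->
  (0 < l <= k)%N -> c k l = chain_sum l (k - l) k.*2.
Proof.
case=> _ _ cG /andP[l_gt0 le_lk].
have G1 i : Gq i i = 1.
  rewrite /Gq !subrr mulr0 expr0z mulr1 (@qbinom_natE i.+1 0); last by lia.
  by rewrite /qpoch !big_ord0 divr1.
have signE r : (r <= k)%N -> (-1) ^ (k%:Z - r%:Z) = (-1) ^+ (k - r) :> Kq.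
  by move=> le_rk; rewrite subzn.
have := @unitriangular_row_unique Gq (signed c k)
  (fun r => (-1) ^+ (k - r) * chain_sum r (k - r) k.*2) k 1 G1 _ l.
rewrite l_gt0 le_lk /signed signE // => H.
apply: (mulfI (expf_neq0 (k - l) (_ : -1 != 0 :> Kq))).
  by rewrite oppr_eq0 oner_eq0.
apply: H => // j /andP[j_gt0 le_jk]; rewrite chain_sum_inverse; last by rewrite j_gt0.
rewrite -(cG k j) //; last by lia.
(* [Gq] vanishes above the diagonal, so the sum may start at [j] instead of 1. *)
rewrite /mul_lower [RHS](@big_cat_nat _ _ _ j) //=; last by lia.
by rewrite [X in X + _]big_nat [X in X + _]big1 ?add0r // => r /andP[_ lt_rj];
  rewrite Gq_upper ?mulr0.
Qed.

(** * Characterisation of the enumerated chains *)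

Lemma chains_uniq l d b : uniq (chains l d b).
Proof.
elim: d b => [|d IHd] b //=.
apply: allpairs_uniq_dep => [|p _|[p ch] [p' ch'] _ _ /= [-> ->]] //.
apply: allpairs_uniq_dep => [|s _|[s t] [s' t'] _ _ /= [-> ->]] //.
  by rewrite filter_uniq // iota_uniq.
by rewrite iota_uniq.
Qed.

(** Position [j] belongs to the path of index [l + d - j.+1]. Entry [j] of [b :: unzip2 ch] is the
    second abscissa of the preceding pair, or [b] at the start. *)
Definition is_chain l d b (ch : seq (nat * nat)) :=
  size ch = d /\ forall j, (j < d)%N ->
    let i := (l + d - j.+1)%N in let p := nth (0, 0)%N ch j in
    [/\ i <= p.1, p.1 <= p.2, p.2 < i.*2 & p.1 < nth 0 (b :: unzip2 ch) j]%N.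

Lemma chainsP l d b ch : ch \in chains l d b <-> is_chain l d b ch.
Proof.
elim: d b ch => [|d IHd] b ch.
  by rewrite inE; split=> [/eqP -> //|[/size0nil -> _]].
split=> [/allpairsPdep[p [ch' [+ /IHd[szch' okch'] ->]]]|[]].
  case/allpairsPdep=> s [t []]; rewrite mem_filter !mem_index_iota.
  move=> /andP[lt_sb /andP[le_s _]] /andP[le_st lt_t] defp; rewrite defp in okch' *.
  split=> [|[|j] ltjd] /=; first by rewrite szch'.
    by rewrite addnS subn1 /=.
  by have := okch' j ltjd; rewrite addnS subSS.
case: ch => // -[s t] ch [szch] okch; apply/allpairsPdep; exists (s, t), ch.
have [] := okch 0%N isT; rewrite addnS subn1 /= => le_s le_st lt_t lt_sb.
split=> //.
  apply/allpairsPdep; exists s, t; rewrite mem_filter !mem_index_iota.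
  by split=> //; lia.
apply/IHd; split=> // j ltjd.
by have := okch j.+1 ltjd; rewrite addnS subSS.
Qed.

Lemma chain_weightE l ch : chain_weight l ch =
  q ^+ (\sum_(l <= i < l + size ch)
     let p := nth (0, 0)%N ch (l + size ch - i.+1) in (p.1 - i + (p.2 - i)))%N.
Proof.
elim: ch => [|p ch IHch] /=; first by rewrite addn0 big_geq.
rewrite IHch addnS big_nat_recr /= ?leq_addr // subnn /= exprD mulrC.
congr (q ^+ _ * _); apply: eq_big_nat => i /andP[_ lt_i].
by rewrite subSn.
Qed.

(** * Lattice paths as successions of horizontal runs *)

Lemma lattice_stepE x y Q :
  lattice_step (x, y) Q = (Q == (x + 1, y)) || (Q == (x, y - 1)).
Proof.
rewrite /lattice_step.
have -> : (x, y) + (1, 0) = (x + 1, y) :> lpoint by congr pair; rewrite addr0.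
by have -> : (x, y) + (0, -1) = (x, y - 1) :> lpoint by congr pair; rewrite addr0.
Qed.

(* The points (x, y), ..., (x + m, y), followed by w. *)
Fixpoint hrun (x y : int) (m : nat) (w : seq lpoint) : seq lpoint :=
  (x, y) :: if m is m'.+1 then hrun (x + 1) y m' w else w.

Lemma mem_hrun x y m w (u v : int) :
  ((u, v) \in hrun x y m w) =
  ((v == y) && (x <= u <= x + m%:Z)) || ((u, v) \in w).
Proof.
elim: m x => [|m IHm] x; rewrite /= inE xpair_eqE; last rewrite IHm orbA.
  by congr (_ || _); lia.
by congr (_ || _); lia.
Qed.

Lemma lattice_path_cons P Q w : is_lattice_path P Q w ->
  w = P :: behead w /\
  (P = Q /\ behead w = [::] \/ is_lattice_path (P.1 + 1, P.2) Q (behead w) \/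
   is_lattice_path (P.1, P.2 - 1) Q (behead w)).
Proof.
case: w => // x [|z p] /and3P[/eqP -> /= pxp /eqP lastQ]; split=> //.
  by left.
right; case/andP: pxp; case: P {x} lastQ => u v /= lastQ.
rewrite lattice_stepE => /orP[/eqP zE pp|/eqP zE pp]; [left|right];
by rewrite zE eqxx -zE pp lastQ eqxx.
Qed.

Lemma lattice_path_le P Q w : is_lattice_path P Q w -> P.1 <= Q.1 /\ Q.2 <= P.2.
Proof.
elim: w P => [|z w IHw] P // /lattice_path_cons[_ /= [[-> _]|[]]] // /IHw /=; lia.
Qed.

Lemma hrun_pathP x y Q w : is_lattice_path (x, y) Q w ->
  exists m w', w = hrun x y m w' /\
    (w' = [::] /\ Q = (x + m%:Z, y) \/ is_lattice_path (x + m%:Z, y - 1) Q w').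
Proof.
elim: w x => [|z w IHw] x // /lattice_path_cons[-> /= [[<- ->]|[]]].
- by exists 0%N, [::]; rewrite addr0; split=> //; left.
- move/IHw => [m [w' [-> H]]]; exists m.+1, w'; split=> //.
  by rewrite intS addrA.
by move=> pw; exists 0%N, w; rewrite addr0; split=> //; right.
Qed.

Lemma hrun_path x y m Q w :
  w = [::] /\ Q = (x + m%:Z, y) \/ is_lattice_path (x + m%:Z, y - 1) Q w ->
  is_lattice_path (x, y) Q (hrun x y m w).
Proof.
elim: m x => [|m IHm] x; rewrite ?addr0 /= eqxx /=.
  case=> [[-> ->] //=|]; case: w => // z w /and3P[/eqP -> pw lw] /=.
  by rewrite lattice_stepE eqxx orbT pw.
rewrite intS addrA => /IHm; case: (hrun _ _ _ _) => // z p /and3P[/eqP -> pp lp] /=.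
by rewrite lattice_stepE eqxx pp.
Qed.

(** The origin [a] is a parameter because the head of the path changes as points are peeled off. *)
Definition down_sum (a : int) (w : seq lpoint) : int :=
  \sum_(s <- steps w | is_down s) (s.1.1 - a).

(** For empty [w] the default head [(x, y)] makes the test fail, as it should: there is no step. *)
Lemma down_sum_cons a x y w : down_sum a ((x, y) :: w) =
  (if head (x, y) w == (x, y - 1) then x - a else 0) + down_sum a w.
Proof.
case: w => [|z w] /=; rewrite /down_sum /steps /= ?big_nil ?big_cons.
  by rewrite xpair_eqE; case: ifP => //; lia.
rewrite {1}/is_down /=.
have -> : (x, y) + (0, -1) = (x, y - 1) :> lpoint by congr pair; rewrite addr0.
by case: ifP; rewrite ?add0r.
Qed.

Lemma head_hrun P x y m w : head P (hrun x y m w) = (x, y).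
Proof. by case: m. Qed.

Lemma down_sum_hrun a x y m w : down_sum a (hrun x y m w) =
  (if head (x, y) w == (x + m%:Z, y - 1) then x + m%:Z - a else 0) +
  down_sum a w.
Proof.
elim: m x => [|m IHm] x; first by rewrite down_sum_cons addr0.
rewrite [LHS]down_sum_cons head_hrun IHm !intS !addrA xpair_eqE.
case: ifP => [|_]; first by lia.
rewrite add0r; case: w {IHm} => //=; rewrite !xpair_eqE.
by do 2 (case: ifP; try lia).
Qed.

(** * The paths of a family and their disjointness *)

Definition straight_path (i : nat) : seq lpoint :=
  hrun (i%:Z - 1) (2 * i%:Z - 1) i [::].

Definition broken_path (i : nat) (p : nat * nat) : seq lpoint :=
  hrun i%:Z (2 * i%:Z + 1) (p.1 - i)
    (hrun p.1%:Z (2 * i%:Z) (p.2 - p.1)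
      (hrun p.2%:Z (2 * i%:Z - 1) (i.*2.-1 - p.2) [::])).

Lemma straight_pathP i w :
  is_lattice_path (ptA i) (ptB i) w <-> w = straight_path i.
Proof.
rewrite /ptA /ptB; split=> [/hrun_pathP[m [w' [-> [[-> [E]]|]]]]|->].
- by rewrite /straight_path; congr hrun; lia.
- by move/lattice_path_le => /= []; lia.
apply: hrun_path; left; split=> //; congr pair; lia.
Qed.

Definition valid_pair i (p : nat * nat) := [&& i <= p.1, p.1 <= p.2 & p.2 < i.*2]%N.

(** [ptA i.+1] lies two rows above [ptB i], so the path consists of exactly three runs, and the pair
    records where it leaves the first two. *)
Lemma broken_pathP i w : is_lattice_path (ptA i.+1) (ptB i) w <->
  exists2 p, valid_pair i p & w = broken_path i p.
Proof.
rewrite /ptA /ptB; have -> : i.+1%:Z - 1 = i by lia.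
have -> : 2 * i.+1%:Z - 1 = 2 * i%:Z + 1 by lia.
split=> [|[[s t] /and3P[/= le_s le_st lt_t] ->]]; last first.
  apply: hrun_path; right; have -> : i%:Z + (s - i)%N = s by lia.
  have -> : 2 * i%:Z + 1 - 1 = 2 * i%:Z by lia.
  apply: hrun_path; right; have -> : s%:Z + (t - s)%N = t by lia.
  by apply: hrun_path; left; split=> //=; congr pair; lia.
case/hrun_pathP=> m1 [w1 [-> [[_ [E1 E2]]|]]]; first by exfalso; lia.
have -> : 2 * i%:Z + 1 - 1 = 2 * i%:Z by lia.
case/hrun_pathP=> m2 [w2 [-> [[_ [E1 E2]]|]]]; first by exfalso; lia.
case/hrun_pathP=> m3 [w3 [-> [[-> [E1]]|]]]; last first.
  by move/lattice_path_le => /= []; lia.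
exists (i + m1, i + m1 + m2)%N; first by rewrite /valid_pair /=; lia.
rewrite /broken_path /= addKn addKn !PoszD.
congr (hrun _ _ _ (hrun _ _ _ (hrun _ _ _ _))).
lia.
Qed.

Lemma mem_straight_path i u v : ((u, v) \in straight_path i) =
  (v == 2 * i%:Z - 1) && (i%:Z - 1 <= u <= 2 * i%:Z - 1).
Proof. by rewrite mem_hrun orbF; lia. Qed.

Lemma mem_broken_path i p u v : valid_pair i p -> ((u, v) \in broken_path i p) =
  [|| (v == 2 * i%:Z + 1) && (i%:Z <= u <= p.1%:Z),
      (v == 2 * i%:Z) && (p.1%:Z <= u <= p.2%:Z) |
      (v == 2 * i%:Z - 1) && (p.2%:Z <= u <= 2 * i%:Z - 1)].
Proof.
rewrite /valid_pair => /and3P[le_s le_st lt_t]; rewrite !mem_hrun in_nil orbF.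
congr [|| _, _ | _]; lia.
Qed.

(** The pair is recovered as the two ends of the run in the middle row [2 * i]. *)
Lemma broken_path_inj i p p' : valid_pair i p -> valid_pair i p' ->
  broken_path i p = broken_path i p' -> p = p'.
Proof.
move=> vp vp' E.
have mE (u : nat) : ((p.1 <= u <= p.2) = (p'.1 <= u <= p'.2))%N.
  have := congr1 (fun w => (u%:Z, 2 * i%:Z) \in w) E.
  rewrite /= !mem_broken_path // eqxx.
  have -> : (2 * i%:Z == 2 * i%:Z + 1) = false by lia.
  have -> : (2 * i%:Z == 2 * i%:Z - 1) = false by lia.
  by rewrite /= !orbF !lez_nat.
case/and3P: vp => _ le_st _; case/and3P: vp' => _ le_st' _.
rewrite {E}; case: p p' mE le_st le_st' => [s t] [s' t'] /= mE le_st le_st'.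
have := mE s; have := mE t; have := mE s'; have := mE t'.
by rewrite !leqnn le_st le_st' /= => *; congr pair; lia.
Qed.

Lemma lambda_size_straight i : lambda_size (straight_path i) = 0.
Proof.
rewrite /lambda_size -/(down_sum _ _) down_sum_hrun /=.
rewrite /down_sum big_nil addr0 xpair_eqE; case: ifP => //; lia.
Qed.

Lemma lambda_size_broken i p : valid_pair i p ->
  lambda_size (broken_path i p) = ((p.1 - i) + (p.2 - i))%N%:Z.
Proof.
case/and3P=> le_s le_st lt_t.
rewrite /lambda_size -/(down_sum _ _) !down_sum_hrun !head_hrun /=.
rewrite /down_sum big_nil addr0 !xpair_eqE.
do 3 (case: ifP; try lia).
Qed.

Definition family_path (k l i : nat) (p : nat * nat) : seq lpoint :=
  if (l <= i < k)%N then broken_path i p else straight_path i.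

Lemma family_pathP k l i w :
  is_lattice_path (start k l i) (ptB i) w <->
  exists2 p, ((l <= i < k)%N -> valid_pair i p) & w = family_path k l i p.
Proof.
rewrite /start /family_path; case: ifP => _.
  rewrite broken_pathP; split=> [[p vp ->]|[p vp ->]]; exists p => //; exact: vp.
rewrite straight_pathP; split=> [->|[p _ ->]] //; by exists (0, 0)%N.
Qed.

(** Path [i] stays in rows 2i-1 to 2i+1, so a common row requires [j = i.+1] and is row 2i+1. There
    path [i] ends at [p.1] and path [j] begins at [p'.2]. The missing index [k] separates the last
    broken path from the straight ones above. *)
Lemma disjoint_family_path k l i j p p' : (i < j)%N -> i != k -> j != k ->
    ((l <= i < k)%N -> valid_pair i p) -> ((l <= j < k)%N -> valid_pair j p') ->
  disjoint_paths (family_path k l i p) (family_path k l j p') <->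
  ((l <= i)%N -> j = i.+1 -> (j < k)%N -> (p.1 < p'.2)%N).
Proof.
rewrite /family_path => lt_ij /eqP neq_ik /eqP neq_jk vp vp'; split.
  move=> dis le_li jE lt_jk; rewrite ltnNge; apply/negP => le_pp'.
  have Ei : (l <= i < k)%N by lia.
  have Ej : (l <= j < k)%N by lia.
  have /and3P[? ? ?] := vp Ei; have /and3P[? ? ?] := vp' Ej.
  (* This is the left end of the lowest run of path [j], in the row shared with path [i]. *)
  case: (dis (p'.2%:Z, 2 * j%:Z - 1)).
  by rewrite Ei Ej !mem_broken_path ?vp ?vp' //; lia.
move=> lt_pp' [u v] [].
case: ifP => [Ei|nEi]; case: ifP => [Ej|nEj].
- have /and3P[? ? ?] := vp Ei; have /and3P[? ? ?] := vp' Ej.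
  rewrite !mem_broken_path ?vp ?vp' //; have [jE|nE] := eqVneq j i.+1; last by lia.
  by have := lt_pp' _ jE; lia.
- have /and3P[? ? ?] := vp Ei.
  by rewrite mem_broken_path ?vp // mem_straight_path; lia.
- have /and3P[? ? ?] := vp' Ej.
  by rewrite mem_broken_path ?vp' // mem_straight_path; lia.
by rewrite !mem_straight_path; lia.
Qed.

(** * Bijection between chains and families *)

Definition chain_pair (k : nat) (ch : seq (nat * nat)) (i : nat) : nat * nat :=
  nth (0, 0)%N ch (k - i.+1).

(** Reindexing by path; the initial bound [k.*2] exceeds every abscissa and so disappears. *)
Lemma is_chainE k l ch : (l <= k)%N ->
  is_chain l (k - l) k.*2 ch <->
  size ch = (k - l)%N /\ forall i, (l <= i < k)%N ->
    valid_pair i (chain_pair k ch i) /\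
    ((i.+1 < k)%N -> ((chain_pair k ch i).1 < (chain_pair k ch i.+1).2)%N).
Proof.
move=> le_lk; rewrite /is_chain subnKC // /chain_pair; split=> -[szch okch]; split=> //.
  move=> i lt_i; have [|] := okch (k - i.+1)%N; first by lia.
  have -> : (k - (k - i.+1).+1 = i)%N by lia.
  move=> le_s le_st lt_t lt_s; split=> [|lt_ik]; first by rewrite /valid_pair le_s le_st.
  move: lt_s; have -> : (k - i.+1 = (k - i.+2).+1)%N by lia.
  by rewrite /= (nth_map (0, 0)%N) //; lia.
move=> j lt_j; have [|] := okch (k - j.+1)%N; first by lia.
have -> : (k - (k - j.+1).+1 = j)%N by lia.
move=> /and3P[le_s le_st lt_t] lt_s; split=> //=.
case: j lt_j lt_s le_s le_st lt_t => [|j] lt_j lt_s le_s le_st lt_t /=; first by lia.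
rewrite (nth_map (0, 0)%N); last by lia.
have := lt_s; have -> : (k - (k - j.+2).+2 = j)%N by lia.
by apply; lia.
Qed.

Definition chain_family (n k l : nat) (ch : seq (nat * nat)) : path_family n k :=
  [ffun i => family_path k l (idx i) (chain_pair k ch (idx i))].

Lemma idxP n k (i : idxset n k) : (0 < idx i <= n)%N /\ idx i != k.
Proof.
by case: i => -[i lt_i] Pi; case/andP: (Pi) => i_gt0 neq_ik; rewrite /idx /= i_gt0.
Qed.

Lemma idx_inj n k : injective (@idx n k).
Proof. by move=> i j /val_inj/val_inj. Qed.

Lemma idx_surj (n k m : nat) : (0 < m <= n)%N -> m != k ->
  exists i : idxset n k, idx i = m.
Proof.
case/andP=> m_gt0 le_mn neq_mk.
have P : (0 < Ordinal (le_mn : m < n.+1)%N)%N &&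
  (Ordinal (le_mn : m < n.+1)%N != k :> nat) by rewrite /= m_gt0.
by exists (exist (fun i : 'I_n.+1 => (0 < i)%N && (i != k :> nat)) _ P).
Qed.

(** Finite choice, used to gather into one chain the pairs that the paths of a family provide
    separately. *)
Lemma seq_choice (T : Type) (x0 : T) d (P : nat -> T -> Prop) :
  (forall j, (j < d)%N -> exists x, P j x) ->
  exists2 s, size s = d & forall j, (j < d)%N -> P j (nth x0 s j).
Proof.
elim: d => [|d IHd] exP; first by exists [::].
have [s szs Ps] := IHd (fun j lt_jd => exP j (ltnW lt_jd)).
have [x Px] := exP d (ltnSn d).
exists (rcons s x) => [|j]; first by rewrite size_rcons szs.
rewrite ltnS leq_eqVlt nth_rcons szs => /predU1P[->|lt_jd].
  by rewrite ltnn eqxx.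
by rewrite lt_jd; apply: Ps.
Qed.

Lemma disjoint_pathsC w w' : disjoint_paths w w' -> disjoint_paths w' w.
Proof. by move=> dis P [Pw Pw']; apply: (dis P). Qed.

Lemma Gamma_bij n k l : (0 < l <= k)%N -> (k <= n)%N ->
  set_bij [set` chains l (k - l) k.*2] (Gamma n k l) (chain_family n k l).
Proof.
case/andP=> l_gt0 le_lk le_kn; split.
- move=> ch /= /chainsP/is_chainE-/(_ le_lk)[szch okch]; split=> [i|i j neq_ij].
    apply/family_pathP; rewrite ffunE; exists (chain_pair k ch (idx i)) => //.
    by case/okch.
  have {neq_ij} : idx i != idx j by rewrite (inj_eq (@idx_inj n k)).
  wlog lt_ij : i j / (idx i < idx j)%N => [IH|_].
    rewrite neq_ltn => /orP[] lt_ij; last apply: disjoint_pathsC; apply: IH => //;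
    by rewrite neq_ltn lt_ij ?orbT.
  have [_ neq_ik] := idxP i; have [_ neq_jk] := idxP j.
  rewrite !ffunE; apply/disjoint_family_path => // [/okch[]|/okch[]|] //.
  move=> le_li jE lt_jk; rewrite jE; apply: (okch _ _).2; last by rewrite -jE.
  by rewrite le_li -jE ltnW //; lia.
- move=> ch ch'; rewrite !in_setE /=.
  move=> /chainsP/is_chainE-/(_ le_lk)[szch okch].
  move=> /chainsP/is_chainE-/(_ le_lk)[szch' okch'] E.
  apply: (@eq_from_nth _ (0, 0)%N); rewrite szch // => j lt_j.
  (* Injectivity: the path of index [k - j.+1] determines entry [j]. *)
  have [||i iE] := @idx_surj n k (k - j.+1); [lia|lia|].
  have lt_i : (l <= k - j.+1 < k)%N by lia.
  have := congr1 (fun g : path_family n k => g i) E.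
  rewrite !ffunE /family_path iE lt_i.
  move/(broken_path_inj (okch _ lt_i).1 (okch' _ lt_i).1).
  by rewrite /chain_pair; have -> : (k - (k - j.+1).+1 = j)%N by lia.
move=> g [pathg disg].
(* Surjectivity. Quantifying over all [i] with the given [idx i] avoids naming a preimage inside the
   predicate. *)
have [j lt_j|ch szch Pch] := @seq_choice _ (0, 0)%N (k - l) (fun j p =>
  forall i : idxset n k, idx i = (k - j.+1)%N ->
    valid_pair (idx i) p /\ g i = family_path k l (idx i) p).
  have [||i iE] := @idx_surj n k (k - j.+1); [lia|lia|].
  have /family_pathP[p vp gE] := pathg i.
  exists p => i' i'E; have -> : i' = i by apply: idx_inj; rewrite i'E.
  by split=> //; apply: vp; rewrite iE; lia.
have okp i : (l <= idx i < k)%N -> valid_pair (idx i) (chain_pair k ch (idx i)) /\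
    g i = family_path k l (idx i) (chain_pair k ch (idx i)).
  by move=> lt_i; apply: Pch; lia.
have gE i : g i = family_path k l (idx i) (chain_pair k ch (idx i)).
  have [/okp[]//|nlt_i] := boolP (l <= idx i < k)%N.
  by have /family_pathP[p _ ->] := pathg i; rewrite /family_path (negPf nlt_i).
exists ch; last by apply/ffunP => i; rewrite ffunE gE.
apply/chainsP/is_chainE => //; split=> // m lt_m.
have [||i iE] := @idx_surj n k m; [lia|lia|rewrite -iE in lt_m *].
have [vi _] := okp i lt_m; split=> // lt_m1.
have [||j jE] := @idx_surj n k (idx i).+1; [lia|lia|].
have neq_ij : i != j by apply/eqP => ij; move: jE; rewrite ij; lia.
have lt_ij : (idx i < idx j)%N by rewrite jE.
have [dis _] := disjoint_family_path lt_ij (idxP i).2 (idxP j).2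
  (fun lt_i => (okp i lt_i).1) (fun lt_j => (okp j lt_j).1).
by rewrite -jE; apply: dis; rewrite -?gE ?jE //; [apply: disg | lia].
Qed.

(** * Weights and the final reindexing *)

Lemma sum_idxset n k (F : nat -> nat) :
  (\sum_(i : idxset n k) F (idx i) = \sum_(1 <= i < n.+1 | i != k) F i)%N.
Proof.
rewrite (big_nat_widenl 1 0) // big_mkord.
rewrite (reindex_omap (val : idxset n k -> 'I_n.+1) insub) => [|i] /=.
  apply: eq_bigl => i; have /andP[i_gt0 neq_ik] := valP i.
  by rewrite neq_ik i_gt0 valK eqxx.
by case/andP=> neq_ik i_gt0; rewrite insubT //= i_gt0.
Qed.

Lemma psi_chain_family n k l ch : (0 < l <= k)%N -> (k <= n)%N ->
  ch \in chains l (k - l) k.*2 -> psi (chain_family n k l ch) = chain_weight l ch.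
Proof.
case/andP=> l_gt0 le_lk le_kn /chainsP/is_chainE-/(_ le_lk)[szch okch].
rewrite chain_weightE szch subnKC // /psi exprnP; congr (_ ^ _).
(* Straight paths contribute 0, so only [l <= i < k] remains, where [i != k] is automatic. *)
pose F i := if (l <= i < k)%N then
  ((chain_pair k ch i).1 - i + ((chain_pair k ch i).2 - i))%N else 0%N.
transitivity (\sum_(i : idxset n k) (F (idx i))%:Z).
  apply: eq_bigr => i _; rewrite ffunE /family_path /F; case: ifP => [/okch[vp _]|_].
    exact: lambda_size_broken.
  exact: lambda_size_straight.
rewrite -(big_morph Posz PoszD (erefl 0%:Z)) sum_idxset; congr Posz.
rewrite (@big_cat_nat _ _ _ l) //=; last by lia.
rewrite (@big_cat_nat _ _ _ k l) //=; last by lia.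
rewrite [X in (X + _)%N]big_nat_cond [X in (X + _)%N]big1; last first.
  by move=> i lt_i; rewrite /F; case: ifP => //; lia.
rewrite [X in (_ + (_ + X))%N]big_nat_cond [X in (_ + (_ + X))%N]big1; last first.
  by move=> i lt_i; rewrite /F; case: ifP => //; lia.
rewrite add0n addn0 big_nat_cond [RHS]big_nat_cond; apply: eq_big => i.
  by case: ltngtP; rewrite ?andbF ?andbT.
by case/andP=> lt_i _; rewrite /F lt_i.
Qed.

Theorem theorem5 (c : infmx) (hc : is_inverse Gq (signed c))
    (n k l : nat) (hl : (1 <= l)%N) (hlk : (l <= k)%N) (hkn : (k <= n)%N) :
  c k l = \sum_(g \in Gamma n k l) psi g.
Proof.
have lk : (0 < l <= k)%N by rewrite hl.
rewrite (inverse_chain_sum hc lk) /chain_sum (reindex_fsbig _ _ _ _ (Gamma_bij lk hkn)).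
rewrite -fsbig_seq ?chains_uniq //; apply: eq_big_seq => ch chP.
by rewrite psi_chain_family.
Qed.
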